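(* Let $u,v\in\mathbb{N}$ and let $J\subseteq\mathsf{k}[x,y]$ be an anchored monomial ideal. Then, for all integers $r\ge\left\lceil\frac{\operatorname{dist}_y(J)}{v}\right\rceil$ and all $\ell\in\mathbb{N}_0$, $$\mathsf{G}\left((x^u,y^v)^{r+1+\ell}J\right)=y^{v\ell}L\ \uplus\ \biguplus_{j=1}^{\ell}x^{uj}y^{v(\ell-j)}M\ \uplus\ x^{u\ell}R,$$ where $$L=\left\{f\in\mathsf{G}\left((x^u,y^v)^{r+1}J\right)\mid\deg_yf\ge rv\right\},$$ $$M=\left\{f\in\mathsf{G}\left((x^u,y^v)^{r+1}J\right)\mid rv\le\deg_yf<(r+1)v\right\},$$ $$R=\left\{f\in\mathsf{G}\left((x^u,y^v)^{r+1}J\right)\mid\deg_yf<rv\right\}.$$ In particular, $$\mu\left((x^u,y^v)^{r+1+\ell}J\right)=\mu\left((x^u,y^v)^{r+1}J\right)+\ell\cdot|M| .$$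
   Context: $\mathsf{k}$ is a field, $\mathbb{N}=\{1,2,\dots\}$, $\mathbb{N}_0=\mathbb{N}\cup\{0\}$. For a nonzero monomial ideal $I\subseteq\mathsf{k}[x,y]$: $\mathsf{G}(I)$ is its minimal set of monomial generators, $\mu(I)=|\mathsf{G}(I)|$, $\gcd(I)$ is the greatest common divisor of all monomials in $I$, and $I$ is anchored if $I=I:\gcd(I)$. $\operatorname{dist}_y(I):=\max\{\deg_yg\mid g\in\mathsf{G}(I:\gcd(I))\}$. For a monomial $m$ and a set $S$ of monomials, $mS=\{mf\mid f\in S\}$; $\uplus$ denotes disjoint union. *)

(* Defs.v *)
From mathcomp Require Import all_boot all_order all_algebra finmap.
From mathcomp Require Import mpoly boolp classical_sets.

Set Implicit Arguments.
Unset Strict Implicit.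
Unset Printing Implicit Defensive.

Import GRing.Theory.
Local Open Scope fset_scope.
Local Open Scope classical_set_scope.
Local Open Scope ring_scope.

(* k[x,y] is {mpoly k[2]}, with x the variable of index 0 and y the variable
   of index 1. A monomial is represented by its exponent vector m : 'X_{1..2},
   so that the product of monomials is (m1 + m2)%MM and m1 divides m2 iff
   (m1 <= m2)%MM. *)
Definition ix : 'I_2 := ord0.
Definition iy : 'I_2 := ord_max.

Definition xpow (a : nat) : 'X_{1..2} := (U_(ix) *+ a)%MM.
Definition ypow (b : nat) : 'X_{1..2} := (U_(iy) *+ b)%MM.
Definition xypow (a b : nat) : 'X_{1..2} := (xpow a + ypow b)%MM.

Definition deg_y (m : 'X_{1..2}) : nat := m iy.

Definition scale_monomials (m : 'X_{1..2}) (S : {fset 'X_{1..2}}) :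
  {fset 'X_{1..2}} := [fset (m + f)%MM | f in S]%fset.

Definition is_gcd (S : set 'X_{1..2}) (g : 'X_{1..2}) : Prop :=
  (forall m, S m -> (g <= m)%MM) /\
  (forall d, (forall m, S m -> (d <= m)%MM) -> (d <= g)%MM).

(* The disjoint union of the sets listed in s equals A. *)
Definition is_disjoint_union (K : choiceType) (A : {fset K})
    (s : seq {fset K}) : Prop :=
  A = (\bigcup_(B <- s) B)%fset /\
  pairwise (fun B C : {fset K} => [disjoint B & C])%fset s.

Section Ideals.
Variable k : fieldType.

(* Unlike idealr_closed in ring_quotient, this allows the unit ideal and
   undecidable membership. *)
Definition is_ideal (I : set {mpoly k[2]}) : Prop :=
  [/\ I 0, (forall f g, I f -> I g -> I (f + g))
    & (forall a f, I f -> I (a * f))].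

Definition ideal_gen (S : set {mpoly k[2]}) : set {mpoly k[2]} :=
  smallest is_ideal S.

Definition ideal_mul (I J : set {mpoly k[2]}) : set {mpoly k[2]} :=
  ideal_gen [set f * g | f in I & g in J].

Definition ideal_exp (I : set {mpoly k[2]}) (n : nat) : set {mpoly k[2]} :=
  iter n (ideal_mul I) setT.

Definition ideal_colon (I : set {mpoly k[2]}) (g : {mpoly k[2]}) :
  set {mpoly k[2]} := [set f | I (f * g)].

Definition monomial_ideal_gen (S : set 'X_{1..2}) : set {mpoly k[2]} :=
  ideal_gen [set 'X_[m] | m in S].

Definition is_monomial_ideal (I : set {mpoly k[2]}) : Prop :=
  exists S : set 'X_{1..2}, I = monomial_ideal_gen S.

Definition ideal_neq0 (I : set {mpoly k[2]}) : Prop := exists2 f, I f & f != 0.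

Definition is_mingens (I : set {mpoly k[2]}) (S : {fset 'X_{1..2}}) : Prop :=
  I = monomial_ideal_gen [set` S] /\
  forall T : {fset 'X_{1..2}}, (T `<` S)%fset -> I <> monomial_ideal_gen [set` T].

(* For a monomial ideal exactly one S satisfies is_mingens I S (finiteness is
   Dickson's lemma), so the default value fset0 plays no role; likewise the
   default value in ideal_gcd plays no role for a nonzero monomial ideal. *)
Definition mingens (I : set {mpoly k[2]}) : {fset 'X_{1..2}} :=
  xget fset0 (is_mingens I).

Definition mu (I : set {mpoly k[2]}) : nat := #|` mingens I|.

Definition ideal_gcd (I : set {mpoly k[2]}) : 'X_{1..2} :=
  xget 0%MM (is_gcd [set m | I 'X_[m]]).

Definition is_anchored (I : set {mpoly k[2]}) : Prop :=
  I = ideal_colon I 'X_[ideal_gcd I].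

Definition dist_y (I : set {mpoly k[2]}) : nat :=
  \max_(g <- mingens (ideal_colon I 'X_[ideal_gcd I])) deg_y g.

Definition xy_power_ideal (u v : nat) : set {mpoly k[2]} :=
  ideal_gen [set 'X_[xpow u]; 'X_[ypow v]].

End Ideals.

Arguments xy_power_ideal : clear implicits.

(* Main.v *)
Require Import Defs.
From mathcomp Require Import all_boot all_order all_algebra finmap.
From mathcomp Require Import mpoly boolp classical_sets.
From mathcomp Require Import zify.

(** A monomial ideal of k[x,y] is known once one knows the staircase of
    exponent pairs (a, b) of its monomials, and its minimal generators are the
    corners of that staircase.  Let U_n be the staircase of
    Q_n = (x^u, y^v)^n J: it consists of the pairs lying above
    (u(n-i) + s, vi + t) for some i <= n and some generator x^s y^t of J.

    The theorem follows from two shifts relating the corners of U_n and of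
    U_(n+1).
    - At low height, b < (n+1)v, the factor y^(v(n+1)) cannot contribute, so
      every pair of U_(n+1) uses at least one x^u.  Hence U_(n+1) at these
      heights is U_n moved by u in the x direction, and so are its corners
      (corner_staircaseS_low).
    - At large height, b >= d = dist_y(J), the corners (a, b) of U_n are in
      bijection with the corners (a, b+v) of U_(n+1)
      (corner_staircaseS_high).  A pair of U_(n+1) which does not come from U_n
      by adding v to the height must have used x^(u(n+1)), hence has abscissa
      at least u(n+1).  Since J is anchored it has a generator y^e, e <= d, so
      U_n already contains (un, b), and u > 0 makes such a pair too far to the
      right to interfere with a corner.

    Iterating, the generators of Q_(r+1+l) of y-degree below rv are x^(ul)R and
    those of y-degree at least (r+l)v are y^(vl)L.  In the l intermediate bands
    of height v one shifts down by y^(v(l-j)) into the band [rv, (r+1)v), then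
    left by x^(uj), which gives a copy of M (disjoint_union_of_shifts).  The
    pieces live in disjoint ranges of y-degrees, and counting them gives the
    formula for mu. *)

Import GRing.Theory.
Local Open Scope fset_scope.
Local Open Scope nat_scope.

(** * Exponent vectors in two variables *)

Lemma xpow_ix a : xpow a ix = a. Proof. by rewrite mulmnE mnm1E mul1n. Qed.
Lemma xpow_iy a : xpow a iy = 0. Proof. by rewrite mulmnE mnm1E. Qed.
Lemma ypow_ix b : ypow b ix = 0. Proof. by rewrite mulmnE mnm1E. Qed.
Lemma ypow_iy b : ypow b iy = b. Proof. by rewrite mulmnE mnm1E mul1n. Qed.
Definition coordE := (@mnmDE 2, xpow_ix, xpow_iy, ypow_ix, ypow_iy).

Lemma ord2_cases (i : 'I_2) : i = ix \/ i = iy.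
Proof. by case: i => [[|[|//]] lt_i]; [left | right]; apply: val_inj. Qed.

Lemma mnm2_eq (m1 m2 : 'X_{1..2}) :
  m1 ix = m2 ix -> m1 iy = m2 iy -> m1 = m2.
Proof. by move=> eq_x eq_y; apply/mnmP=> i; case: (ord2_cases i) => ->. Qed.

Lemma mnm2_leP (m1 m2 : 'X_{1..2}) :
  (m1 <= m2)%MM <-> m1 ix <= m2 ix /\ m1 iy <= m2 iy.
Proof.
split=> [/mnm_lepP le_m|[le_x le_y]]; first by split; apply: le_m.
by apply/mnm_lepP=> i; case: (ord2_cases i) => ->.
Qed.

(** * Monomial ideals and their minimal generators *)

Section MonomialIdeals.
Variable k : fieldType.
Implicit Types (I : set {mpoly k[2]}) (S T : set 'X_{1..2}).

Lemma ideal_gen_ideal (F : set {mpoly k[2]}) : is_ideal (ideal_gen F).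
Proof.
split=> [J [[]]//|f g Sf Sg J JP|a f Sf J JP]; move: (JP) => [[J0 JD JM] _].
  by apply: JD; [exact: Sf | exact: Sg].
by apply: JM; exact: Sf.
Qed.

(** The polynomials all of whose monomials are divisible by an element of S
    form an ideal, so the smallest ideal containing S is no larger. *)
Lemma monomial_ideal_genP S (f : {mpoly k[2]}) :
  monomial_ideal_gen S f <->
  forall m, m \in msupp f -> exists2 s, S s & (s <= m)%MM.
Proof.
split=> [|Sf].
  apply: (@smallest_sub _ _ _ [set f : {mpoly k[2]} |
    forall m, m \in msupp f -> exists2 s, S s & (s <= m)%MM]) => /=.
    split=> [m|g h Sg Sh m|a g Sg m]; first by rewrite -mpolyC0 msupp0.
      by move/msuppD_le; rewrite mem_cat => /orP[/Sg|/Sh].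
    move/msuppM_le/allpairsP => -[[m1 m2] /= [_ /Sg[s Ss le_s] ->]].
    by exists s => //; apply: lepm_trans le_s _; exact: lem_addl.
  move=> _ [s Ss <-] m; rewrite msuppX mem_seq1 => /eqP ->.
  by exists s => //; exact: lepm_refl.
have [S0 SD SM] := ideal_gen_ideal [set 'X_[m] | m in S].
rewrite (mpolyE f) big_seq; elim/big_ind: _ => // m /Sf[s Ss /submK <-].
rewrite mpolyXD -mul_mpolyC mulrA; apply: SM.
by apply: sub_gen_smallest; exists s.
Qed.

Lemma monomial_ideal_genX S m :
  @monomial_ideal_gen k S 'X_[m] <-> exists2 s, S s & (s <= m)%MM.
Proof.
rewrite monomial_ideal_genP msuppX; split=> [Sm|Sm m'].
  by apply: Sm; rewrite mem_head.
by rewrite mem_seq1 => /eqP ->.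
Qed.

Lemma ideal_mul_monomial S T :
  ideal_mul (@monomial_ideal_gen k S) (monomial_ideal_gen T) =
  monomial_ideal_gen [set (s + t)%MM | s in S & t in T].
Proof.
apply/seteqP; split; apply: smallest_sub.
- exact: ideal_gen_ideal.
- move=> _ [f /monomial_ideal_genP Sf [g /monomial_ideal_genP Tg <-]].
  apply/monomial_ideal_genP => m /msuppM_le/allpairsP[[m1 m2] /= []].
  move=> /Sf[s Ss /mnm_lepP le_s] /Tg[t Tt /mnm_lepP le_t] ->.
  exists (s + t)%MM; first by exists s => //; exists t.
  by apply/mnm_lepP=> i; rewrite !mnmDE leq_add.
- exact: ideal_gen_ideal.
- move=> _ [_ [s Ss [t Tt <-]] <-]; apply: sub_gen_smallest.
  exists 'X_[s]; first by apply: sub_gen_smallest; exists s.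
  exists 'X_[t]; first by apply: sub_gen_smallest; exists t.
  by rewrite mpolyXD.
Qed.

Lemma xy_power_ideal_exp u v n :
  ideal_exp (xy_power_ideal k u v) n =
  monomial_ideal_gen
    [set m | exists2 i, i <= n & m = xypow (u * (n - i)) (v * i)].
Proof.
have xyE : xy_power_ideal k u v =
    monomial_ideal_gen [set m | m = xpow u \/ m = ypow v].
  congr ideal_gen; apply/seteqP; split=> [_ [->|->]|_ [_ [->|->] <-]].
  - by exists (xpow u) => //; left.
  - by exists (ypow v) => //; right.
  - by left.
  - by right.
elim: n => [|n IHn].
  apply/seteqP; split=> // f _; apply/monomial_ideal_genP => m _.
  exists 0%MM; last by apply/mnm_lepP=> i; rewrite mnm0E.
  by exists 0 => //; apply: mnm2_eq; rewrite !coordE mnm0E ?muln0.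
rewrite /ideal_exp iterS -/(ideal_exp _ n) IHn xyE ideal_mul_monomial.
congr monomial_ideal_gen; apply/seteqP; split=> [_ [p xyp [_ [i le_i ->] <-]]|].
  case: xyp => ->; [exists i | exists i.+1]; rewrite ?subSS //; first lia.
  - by apply: mnm2_eq; rewrite !coordE ?subSn // ?mulnS; lia.
  - by apply: mnm2_eq; rewrite !coordE ?mulnS; lia.
move=> _ [[|i] le_i ->].
  exists (xpow u); first by left.
  exists (xypow (u * (n - 0)) (v * 0)); first by exists 0.
  by apply: mnm2_eq; rewrite !coordE ?subn0 ?mulnS; lia.
exists (ypow v); first by right.
exists (xypow (u * (n - i)) (v * i)); first by exists i.
by apply: mnm2_eq; rewrite !coordE ?subSS ?mulnS; lia.
Qed.

(** The intrinsic description of the minimal generators of I. *)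
Definition min_monomial I m :=
  I 'X_[m] /\ forall m', (m' <= m)%MM -> I 'X_[m'] -> m' = m.

Lemma min_monomial_below I m :
  I 'X_[m] -> exists2 s, min_monomial I s & (s <= m)%MM.
Proof.
have [d] := ubnP (mdeg m); elim: d m => // d IHd m lt_md Im.
case: (pselect (min_monomial I m)) => [min_m|].
  by exists m => //; exact: lepm_refl.
move=> /not_andP[//|/existsNP[m' /not_implyP[le_m' /not_implyP[Im' neq_m']]]].
have [|s min_s le_s] := IHd m' _ Im'.
  rewrite -(submK le_m') mdegD in lt_md.
  have : mdeg (m - m') != 0.
    rewrite mdeg_eq0; apply/eqP=> m0; case: neq_m'.
    by rewrite -(submK le_m') m0 add0m.
  by move: lt_md; lia.
by exists s => //; exact: lepm_trans le_s le_m'.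
Qed.

(** Below a generator m there is no other monomial of I: otherwise some other
    generator would divide m, and m could be removed. *)
Lemma is_mingensP I A :
  is_mingens I A -> forall m, m \in A <-> min_monomial I m.
Proof.
move=> [I_A min_A] m.
have IX m' : I 'X_[m'] <-> exists2 s, s \in A & (s <= m')%MM.
  by rewrite [in I _]I_A monomial_ideal_genX.
split=> [Am|[/IX[s As le_s] min_m]]; last first.
  by rewrite -(min_m s le_s) //; apply/IX; exists s => //; exact: lepm_refl.
split=> [|m' le_m' /IX[s As le_s]].
  by apply/IX; exists m => //; exact: lepm_refl.
have [eq_sm|neq_sm] := eqVneq s m.
  subst s; apply/mnmP=> i; apply/eqP; rewrite eqn_leq.
  by rewrite (mnm_lepP le_m') (mnm_lepP le_s).
have ltAm : A `\ m `<` A by rewrite fproperD1.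
case: (min_A _ ltAm); rewrite I_A.
apply/seteqP; split=> f /monomial_ideal_genP Sf;
  apply/monomial_ideal_genP => p /Sf[t].
  move=> At le_t; have [eq_tm|neq_tm] := eqVneq t m; last first.
    by exists t => //; rewrite /= in_fsetD1 neq_tm.
  exists s; first by rewrite /= in_fsetD1 neq_sm.
  by apply: lepm_trans le_s _; apply: lepm_trans le_m' _; rewrite -eq_tm.
by rewrite /= in_fsetD1 => /andP[_ At] le_t; exists t.
Qed.

(** Pure powers x^a and y^b in I bound both exponents of a minimal monomial, so
    there are finitely many of them: with pure powers at hand, the finiteness in
    Dickson's lemma is immediate. *)
Lemma exists_mingens I a b :
  is_monomial_ideal I -> I 'X_[xpow a] -> I 'X_[ypow b] ->
  exists A, is_mingens I A.
Proof.
move=> [S I_S] Ia Ib.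
pose A := [fset m in [fset bmnm m | m : 'X_{1..2 < (a + b).+1}] |
            `[< min_monomial I m >] ].
have AP m : m \in A <-> min_monomial I m.
  rewrite !inE; split=> [/andP[_ /asboolP]//|min_m].
  apply/andP; split; last exact/asboolP.
  have lt_m : mdeg m < (a + b).+1.
    rewrite ltnS mdegE big_ord_recl big_ord1; case: min_m => Im min_m.
    have -> : lift ord0 ord0 = iy by apply: val_inj.
    apply: leq_add; rewrite leqNgt; apply/negP => lt.
      have le_m : (xpow a <= m)%MM.
        by apply/mnm2_leP; rewrite !coordE; split=> //; exact: ltnW.
      by move: lt; rewrite -(min_m _ le_m Ia) xpow_ix ltnn.
    have le_m : (ypow b <= m)%MM.
      by apply/mnm2_leP; rewrite !coordE; split=> //; exact: ltnW.
    by move: lt; rewrite -(min_m _ le_m Ib) ypow_iy ltnn.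
  by apply/imfsetP; exists (BMultinom lt_m).
exists A; split=> [|T /andP[_ /fsubsetPn[m Am /negP Tm]] I_T].
  rewrite {1}I_S; apply/seteqP; split=> f /monomial_ideal_genP Sf;
    apply/monomial_ideal_genP => m /Sf[s].
    move=> Ss le_s; have [|t /AP At le_t] := @min_monomial_below I s.
      by rewrite I_S monomial_ideal_genX; exists s => //; exact: lepm_refl.
    by exists t => //; exact: lepm_trans le_t le_s.
  move=> /AP[+ _] le_s; rewrite I_S monomial_ideal_genX => -[t St le_t].
  by exists t => //; exact: lepm_trans le_t le_s.
move/AP: Am => [Im min_m]; move: (Im).
rewrite [I in I _]I_T monomial_ideal_genX.
move=> [t /= Tt le_t]; apply: Tm; rewrite -(min_m _ le_t) //.
by rewrite I_T monomial_ideal_genX; exists t => //; exact: lepm_refl.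
Qed.

Lemma mingensP I a b :
  is_monomial_ideal I -> I 'X_[xpow a] -> I 'X_[ypow b] ->
  is_mingens I (mingens I).
Proof. by move=> monI Ia Ib; apply: xgetPex; apply: exists_mingens Ia Ib. Qed.

(** If I : g = I with g = gcd(I), then dividing a monomial of I by g stays in I,
    so every power of g divides every monomial of I and g = 1.  Hence some
    monomial of I is free of y, and some monomial of I is free of x. *)
Lemma anchored_pure_powers I :
  is_monomial_ideal I -> ideal_neq0 I -> is_anchored I ->
  exists a b, I 'X_[xpow a] /\ I 'X_[ypow b].
Proof.
move=> [S I_S] [f If f_neq0] anchI.
have IX m : I 'X_[m] <-> exists2 s, S s & (s <= m)%MM.
  by rewrite [in I _]I_S monomial_ideal_genX.
have [m0 Im0] : exists m, I 'X_[m].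
  have /mlead_supp := f_neq0; move: If.
  rewrite [in I _]I_S => /monomial_ideal_genP/[apply].
  by move=> [s Ss _]; exists s; apply/IX; exists s => //; exact: lepm_refl.
(* The gcd exists: its exponents are the least exponents occurring in I. *)
have coord_min i : exists2 m, I 'X_[m] & forall m', I 'X_[m'] -> m i <= m' i.
  have ex_c : exists c, `[< exists2 m, I 'X_[m] & m i = c >].
    by exists (m0 i); apply/asboolP; exists m0.
  case: (ex_minnP ex_c) => c /asboolP[m Im <-] min_c; exists m => // m' Im'.
  by apply: min_c; apply/asboolP; exists m'.
have [mx Imx min_x] := coord_min ix; have [my Imy min_y] := coord_min iy.
have gcdI : is_gcd [set m | I 'X_[m]] (ideal_gcd I).
  apply: xgetPex; exists (xypow (mx ix) (my iy)); split=> [m /= Im|d le_d].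
    apply/mnm2_leP; rewrite !coordE addn0 add0n.
    by split; [exact: min_x | exact: min_y].
  apply/mnm2_leP; rewrite !coordE addn0 add0n.
  by split; [have /mnm2_leP[] := le_d _ Imx | have /mnm2_leP[] := le_d _ Imy].
have [gcd_le gcd_max] := gcdI.
have gcd_mul n m : I 'X_[m] -> (ideal_gcd I *+ n <= m)%MM.
  elim: n m => [|n IHn] m Im; first by apply/mnm_lepP=> i; rewrite mulmnE muln0.
  have le_m := gcd_le _ Im.
  have /IHn /mnm_lepP le_nm : I 'X_[m - ideal_gcd I].
    have : ideal_colon I 'X_[ideal_gcd I] 'X_[m - ideal_gcd I].
      by rewrite /ideal_colon /= -mpolyXD submK.
    by rewrite -anchI.
  apply/mnm_lepP=> i; move/mnm_lepP: le_m => /(_ i); move: (le_nm i).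
  by rewrite mulmS mnmDE mnmBE; lia.
have gcd0 i : ideal_gcd I i = 0.
  have /mnm_lepP/(_ i) := gcd_mul (m0 i).+1 _ Im0; rewrite mulmnE.
  by case: (ideal_gcd I i) => // c; rewrite mulSn; lia.
have min0 i m : (forall m', I 'X_[m'] -> m i <= m' i) -> m i = 0.
  move=> min_m; case: (posnP (m i)) => // m_gt0.
  have /mnm_lepP/(_ i) : (U_(i) <= ideal_gcd I)%MM.
    by apply: gcd_max => m' /min_m; rewrite lep1mP; lia.
  by rewrite gcd0 mnm1E eqxx.
exists (my ix), (mx iy); split.
  have -> // : xpow (my ix) = my.
  by apply: mnm2_eq; rewrite !coordE ?(min0 _ _ min_x) ?(min0 _ _ min_y).
have -> // : ypow (mx iy) = mx.
by apply: mnm2_eq; rewrite !coordE ?(min0 _ _ min_x) ?(min0 _ _ min_y).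
Qed.

End MonomialIdeals.

Arguments min_monomial {k}.
Arguments is_mingensP {k I A}.
Arguments mingensP {k I a b}.
Arguments anchored_pure_powers {k I}.
(** * Corners of the staircase of a product of powers *)

Section Staircase.
Variables (u v : nat) (S : set (nat * nat)).
Hypotheses (u_gt0 : 0 < u) (v_gt0 : 0 < v).

(** The exponent pairs of the monomials of (x^u, y^v)^n J, where S lists the
    exponent pairs of generators of J. *)
Definition staircase (n : nat) : set (nat * nat) := fun p =>
  exists i s t,
    [/\ i <= n, S (s, t), u * (n - i) + s <= p.1 & v * i + t <= p.2].

Definition corner (U : set (nat * nat)) : set (nat * nat) := fun p =>
  U p /\ forall q, q.1 <= p.1 -> q.2 <= p.2 -> U q -> q = p.

(** Below height (n+1)v the generator y^(v(n+1)) of (x^u, y^v)^(n+1) is out of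
    reach, so a factor x^u can always be split off. *)
Lemma corner_staircaseS_low n a b : b < n.+1 * v ->
  corner (staircase n.+1) (a, b) <->
  u <= a /\ corner (staircase n) (a - u, b).
Proof.
move=> b_lt.
have shift c d : d < n.+1 * v ->
    staircase n.+1 (c, d) <-> u <= c /\ staircase n (c - u, d).
  move=> d_lt; split=> [[i [s [t [/= le_i Sst le_c le_d]]]]|].
    have le_in : i <= n by move: le_d; clear -d_lt v_gt0; nia.
    have eq_u : u * (n.+1 - i) = u + u * (n - i) by rewrite subSn // mulnS.
    rewrite eq_u in le_c.
    by split; [nia | exists i, s, t; split=> //=; nia].
  move=> [le_u [i [s [t [/= le_i Sst le_c le_d]]]]].
  have eq_u : u * (n.+1 - i) = u + u * (n - i) by rewrite subSn // mulnS.
  by exists i, s, t; split=> //=; rewrite ?eq_u; nia.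
split=> [[/(shift _ _ b_lt)[le_u Uab] min_ab]|[le_u [Uab min_ab]]].
  split=> //; split=> // -[c d] /= le_c le_d Ucd.
  have Ucd' : staircase n.+1 (c + u, d).
    by apply/shift; [lia | rewrite addnK; split=> //; lia].
  have [<- <-] : (c + u, d) = (a, b) by apply: min_ab => //=; lia.
  by rewrite addnK.
split; first by apply/shift.
move=> [c d] /= le_c le_d /shift[]; first nia.
move=> le_uc Ucd.
have [eq_c ->] : (c - u, d) = (a - u, b) by apply: min_ab => //=; lia.
by congr (_, _); lia.
Qed.

(** A point of the staircase n.+1 either comes from the staircase n by adding v
    to its height, or has abscissa at least u(n+1).  The pair (0, e) puts
    (un, b) in the staircase n for all b >= h, which is strictly to the left of
    every point of the second kind: such a point is neither a corner at height
    b + v nor an obstruction to one. *)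
Lemma corner_staircaseS_high h e n a b :
  (forall s t, S (s, t) -> t <= h) -> S (0, e) -> h <= b ->
  corner (staircase n.+1) (a, b + v) <-> corner (staircase n) (a, b).
Proof.
move=> le_h S0e le_hb.
have le_eh := le_h _ _ S0e.
have up c d : staircase n (c, d) -> staircase n.+1 (c, d + v).
  move=> [i [s [t [/= le_i Sst le_c le_d]]]].
  exists i.+1, s, t; split=> //=; rewrite mulnS; lia.
(* The left alternative is the case i = 0, where no factor y^v is used. *)
have down c d : staircase n.+1 (c, d) ->
    u * n.+1 <= c \/ v <= d /\ staircase n (c, d - v).
  move=> [[|i] [s [t [/= le_i Sst le_c le_d]]]]; [left; nia | right].
  rewrite mulnS in le_d; split; first nia.
  by exists i, s, t; split=> //=; nia.
have top c d : u * n <= c -> h <= d -> staircase n (c, d).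
  by move=> le_c le_d; exists 0, 0, e; split=> //=; nia.
split=> [[Uab min_ab]|[Uab min_ab]].
  split.
    case: (down _ _ Uab) => [le_a|[_]]; last by rewrite addnK.
    by apply: top => //; rewrite mulnS in le_a; nia.
  move=> [c d] /= le_c le_d /up Ucd.
  have [-> eq_d] : (c, d + v) = (a, b + v) by apply: min_ab => //=; lia.
  by congr (_, _); lia.
split; first exact: up.
move=> [c d] /= le_c le_d /down[le_un|[le_vd Ucd]].
  (* The corner (a, b) would have to be (un, b), yet u(n+1) <= c <= a. *)
  have [] : (u * n, b) = (a, b); last nia.
  by apply: min_ab => /=; [nia | nia | exact: top].
have [-> eq_d] : (c, d - v) = (a, b) by apply: min_ab => //=; lia.
by congr (_, _); lia.
Qed.

Lemma corner_staircase_low n j a b : b < n.+1 * v ->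
  corner (staircase (n + j)) (a, b) <->
  u * j <= a /\ corner (staircase n) (a - u * j, b).
Proof.
move=> b_lt; elim: j a => [|j IHj] a.
  by rewrite muln0 subn0 addn0; split=> // -[].
have b_lt' : b < (n + j).+1 * v.
  by apply: leq_trans b_lt _; rewrite leq_mul2r; lia.
rewrite addnS; split.
  move=> /(corner_staircaseS_low _ _ _ b_lt')[le_u /IHj[le_uj]].
  by rewrite -subnDA -mulnS => ?; split=> //; nia.
rewrite mulnS subnDA => -[le_u ?]; apply/corner_staircaseS_low => //.
by split; [nia | apply/IHj; split=> //; nia].
Qed.

Lemma corner_staircase_high h e n j a b :
  (forall s t, S (s, t) -> t <= h) -> S (0, e) -> h <= b ->
  corner (staircase (n + j)) (a, b + v * j) <-> corner (staircase n) (a, b).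
Proof.
move=> le_h S0e le_hb; elim: j => [|j IHj]; first by rewrite muln0 !addn0.
rewrite mulnSr addnA addnS -IHj.
by apply: (corner_staircaseS_high h e) => //; lia.
Qed.

End Staircase.

(** * The staircase of the ideals (x^u, y^v)^n J *)

Section PowerProducts.
Variables (k : fieldType) (u v : nat).

Lemma min_monomial_corner (I : set {mpoly k[2]}) (U : set (nat * nat)) :
  (forall m, I 'X_[m] <-> U (m ix, m iy)) ->
  forall m, min_monomial I m <-> corner U (m ix, m iy).
Proof.
move=> IU m; split=> -[/IU Um min_m]; split=> //.
  move=> [a b] /= le_a le_b Uab.
  have -> : m = xypow a b; last by rewrite !coordE addn0.
  apply/esym/min_m; first by apply/mnm2_leP; rewrite !coordE addn0.
  by apply/IU; rewrite !coordE addn0.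
move=> m' /mnm2_leP[le_x le_y] /IU Um'.
have [] := min_m (m' ix, m' iy) le_x le_y Um'; exact: mnm2_eq.
Qed.

Lemma power_product_staircase (A : set 'X_{1..2}) n (m : 'X_{1..2}) :
  ideal_mul (ideal_exp (xy_power_ideal k u v) n) (monomial_ideal_gen A) 'X_[m]
  <-> staircase u v [set p | A (xypow p.1 p.2)] n (m ix, m iy).
Proof.
rewrite xy_power_ideal_exp ideal_mul_monomial monomial_ideal_genX.
split=> [[_ [_ [i le_i ->] [s As <-]] /mnm2_leP]|].
  rewrite !coordE => -[le_x le_y].
  exists i, (s ix), (s iy); split=> //=; try lia.
  have -> // : xypow (s ix) (s iy) = s.
  by apply: mnm2_eq; rewrite !coordE ?addn0.
move=> [i [s [t [le_i /= Ast le_x le_y]]]].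
exists (xypow (u * (n - i)) (v * i) + xypow s t)%MM.
  exists (xypow (u * (n - i)) (v * i)); first by exists i.
  by exists (xypow s t).
by apply/mnm2_leP; rewrite !coordE !addn0.
Qed.

Lemma mingens_power_product (A : set 'X_{1..2}) a b n (m : 'X_{1..2}) :
  A (xpow a) -> A (ypow b) ->
  m \in mingens (ideal_mul (ideal_exp (xy_power_ideal k u v) n)
                           (monomial_ideal_gen A)) <->
  corner (staircase u v [set p | A (xypow p.1 p.2)] n) (m ix, m iy).
Proof.
move=> Aa Ab; set I := ideal_mul _ _.
have IU := power_product_staircase A n.
have xy0 s : xypow s 0 = xpow s by apply: mnm2_eq; rewrite !coordE ?addn0.
have x0y t : xypow 0 t = ypow t by apply: mnm2_eq; rewrite !coordE ?addn0.
rewrite (@is_mingensP _ I (mingens I)); first exact: min_monomial_corner.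
apply: (@mingensP _ _ (u * n + a) (v * n + b)).
- by rewrite /I xy_power_ideal_exp ideal_mul_monomial; eexists.
- by apply/IU; exists 0, a, 0; rewrite /= xy0 !coordE; split=> //; lia.
- by apply/IU; exists n, 0, b; rewrite /= x0y !coordE; split=> //; lia.
Qed.

End PowerProducts.

(** * Disjoint unions of sets of monomials *)

Lemma card_disjoint_union (K : choiceType) (A : {fset K}) s :
  is_disjoint_union A s -> #|` A| = \sum_(B <- s) #|` B|.
Proof.
move=> [-> {A}]; elim: s => [|B s IHs] /=; first by rewrite !big_nil cardfs0.
move=> /andP[/allP dBs /IHs eq_s]; rewrite !big_cons -eq_s -cardfsUI.
suff /eqP -> : B `&` \bigcup_(C <- s) C == fset0 by rewrite cardfs0 addn0.
rewrite fsetI_eq0; apply/fdisjointP => x Bx; apply/negP => /bigfcupP[C].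
by rewrite andbT => /dBs /fdisjointP/(_ x Bx)/negP.
Qed.

Lemma disjoint_deg_y (B C : {fset 'X_{1..2}}) t :
  (forall m, m \in B -> t <= deg_y m) -> (forall m, m \in C -> deg_y m < t) ->
  [disjoint B & C].
Proof.
move=> le_B lt_C; apply/fdisjointP => m /le_B; rewrite leqNgt.
by apply: contra => /lt_C.
Qed.

Lemma scale_monomialsP p A m :
  reflect (exists2 f, f \in A & m = (p + f)%MM) (m \in scale_monomials p A).
Proof. exact: imfsetP. Qed.

Lemma card_scale_monomials p A : #|` scale_monomials p A| = #|` A|.
Proof.
by rewrite card_imfset //= => f g; rewrite ![(p + _)%MM]addmC; exact: addIm.
Qed.

(** * Assembling the generators from the shifts *)

Section Decomposition.
Variables (G : nat -> {fset 'X_{1..2}}) (u v r l : nat).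
Hypothesis v_gt0 : 0 < v.
Hypothesis shift_low : forall n j m, deg_y m < n.+1 * v ->
  m \in G (n + j) <-> exists2 f, f \in G n & m = (f + xpow (u * j))%MM.
Hypothesis shift_high : forall n j m, r * v <= deg_y m ->
  (m + ypow (v * j))%MM \in G (n + j) <-> m \in G n.

Let L := [fset f in G r.+1 | r * v <= deg_y f].
Let M := [fset f in G r.+1 | r * v <= deg_y f < r.+1 * v].
Let R := [fset f in G r.+1 | deg_y f < r * v].
Let blocks := scale_monomials (ypow (v * l)) L
  :: rcons [seq scale_monomials (xypow (u * j) (v * (l - j))) M | j <- iota 1 l]
           (scale_monomials (xpow (u * l)) R).

Let LP m : m \in L <-> m \in G r.+1 /\ r * v <= deg_y m.
Proof. by rewrite !inE; split=> [/andP[]|[-> ->]]. Qed.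

Let MP m : m \in M <-> m \in G r.+1 /\ r * v <= deg_y m < r.+1 * v.
Proof. by rewrite !inE; split=> [/andP[]|[-> ->]]. Qed.

Let RP m : m \in R <-> m \in G r.+1 /\ deg_y m < r * v.
Proof. by rewrite !inE; split=> [/andP[]|[-> ->]]. Qed.

Lemma deg_yDx m c : deg_y (m + xpow c)%MM = deg_y m.
Proof. by rewrite /deg_y !coordE addn0. Qed.

Lemma deg_yDy m c : deg_y (m + ypow c)%MM = deg_y m + c.
Proof. by rewrite /deg_y !coordE. Qed.

Lemma xypowD m c d : (xypow c d + m = m + xpow c + ypow d)%MM.
Proof. by rewrite addmC /xypow addmA. Qed.

Lemma ypow_split c m : c <= deg_y m -> exists m', m = (m' + ypow c)%MM.
Proof.
move=> le_m; exists (m - ypow c)%MM; rewrite submK //.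
by apply/mnm2_leP; rewrite !coordE.
Qed.

(** The y-degrees of the blocks lie in consecutive intervals, in decreasing
    order along the list. *)
Lemma blocks_disjoint :
  pairwise (fun B C : {fset 'X_{1..2}} => [disjoint B & C]) blocks.
Proof.
have inL m : m \in scale_monomials (ypow (v * l)) L -> r * v + v * l <= deg_y m.
  move=> /scale_monomialsP[f /LP[_ le_f] ->].
  by rewrite addmC deg_yDy leq_add2r.
have inR m : m \in scale_monomials (xpow (u * l)) R -> deg_y m < r * v.
  by move=> /scale_monomialsP[f /RP[_ le_f] ->]; rewrite addmC deg_yDx.
have inM j m : m \in scale_monomials (xypow (u * j) (v * (l - j))) M ->
    r * v + v * (l - j) <= deg_y m < r * v + v * (l - j) + v.
  move=> /scale_monomialsP[f /MP[_ le_f] ->]; rewrite xypowD deg_yDy deg_yDx.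
  by move: le_f; rewrite mulSn; lia.
rewrite /blocks pairwise_cons pairwise_rcons; apply/and3P; split.
- apply/allP => C; rewrite mem_rcons inE => /orP[/eqP ->|/mapP[j]].
    apply: disjoint_deg_y inL _ => m /inR lt_m; nia.
  rewrite mem_iota => lt_j ->.
  apply: disjoint_deg_y inL _ => m /inM /andP[_ lt_m].
  by apply: leq_trans lt_m _; nia.
- apply/allP => _ /mapP[j _ ->]; apply: disjoint_deg_y _ inR => m /inM; nia.
rewrite pairwise_map; apply/(pairwiseP 0) => i j.
rewrite !inE size_iota => lt_i lt_j lt_ij; rewrite /= !nth_iota //.
apply: (disjoint_deg_y _ _ (r * v + v * (l - (1 + i)))) => m /inM.
  by move=> /andP[].
by move=> /andP[_ lt_m]; apply: leq_trans lt_m _; nia.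
Qed.

(** The y-degree of m decides which block can contain it.  A monomial in the
    band [rv + vq, rv + v(q+1)) with q < l is reached from the band of M in two
    stages: l - q low shifts by x^u, still at y-degree below (r+1)v, followed by
    q high shifts by y^v. *)
Lemma mem_blocks m : m \in G (r.+1 + l) <-> exists2 B, B \in blocks & m \in B.
Proof.
split=> [Gm|[B]].
  have [lt_m|le_m] := ltnP (deg_y m) (r * v).
    exists (scale_monomials (xpow (u * l)) R).
      by rewrite inE mem_rcons mem_head orbT.
    have [f Gf eq_m] :
        exists2 f, f \in G r.+1 & m = (f + xpow (u * l))%MM.
      by apply/shift_low => //; nia.
    apply/scale_monomialsP; exists f; last by rewrite addmC.
    by apply/RP; split=> //; rewrite eq_m deg_yDx in lt_m.
  have [le_lm|lt_lm] := leqP (r * v + v * l) (deg_y m).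
    have [f eq_m] := ypow_split _ m (leq_trans (leq_addl _ _) le_lm).
    rewrite eq_m deg_yDy leq_add2r in le_lm Gm *.
    exists (scale_monomials (ypow (v * l)) L); first by rewrite mem_head.
    apply/scale_monomialsP; exists f; last by rewrite addmC.
    by apply/LP; split=> //; apply/(shift_high r.+1 l).
  (* m lies in the q-th band of height v above rv. *)
  pose q := (deg_y m - r * v) %/ v.
  have le_q : v * q <= deg_y m - r * v by rewrite [v * _]mulnC leq_divM.
  have lt_q : deg_y m - r * v < v * q.+1 by rewrite [v * _]mulnC ltn_ceil.
  have q_lt : q < l by rewrite ltn_divLR //; lia.
  have [m1 eq_m1] := ypow_split _ m (leq_trans le_q (leq_subr _ _)).
  have deg_m : deg_y m = deg_y m1 + v * q by rewrite eq_m1 deg_yDy.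
  pose j := l - q; have eq_l : r.+1 + l = r.+1 + j + q by rewrite /j; lia.
  have le_m1 : r * v <= deg_y m1 by lia.
  have lt_m1 : deg_y m1 < r.+1 * v by rewrite mulnS in lt_q; rewrite mulSn; lia.
  have Gm1 : m1 \in G (r.+1 + j).
    by apply/(shift_high (r.+1 + j) q _ le_m1); rewrite -eq_l -eq_m1.
  have [f Gf eq_m2] : exists2 f, f \in G r.+1 & m1 = (f + xpow (u * j))%MM.
    by apply/shift_low => //; nia.
  exists (scale_monomials (xypow (u * j) (v * (l - j))) M).
    rewrite inE mem_rcons inE; apply/or3P; apply: Or33.
    by apply/mapP; exists j => //; rewrite mem_iota /j; lia.
  apply/scale_monomialsP; exists f.
    by rewrite eq_m2 deg_yDx in le_m1 lt_m1; apply/MP; rewrite le_m1.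
  by rewrite xypowD eq_m1 eq_m2 /j subKn // ltnW.
have low f n j : deg_y f < n.+1 * v -> f \in G n ->
    (f + xpow (u * j))%MM \in G (n + j).
  by move=> lt_f Gf; apply/shift_low; [rewrite deg_yDx | exists f].
rewrite inE mem_rcons inE => /or3P[/eqP ->|/eqP ->|/mapP[j]].
- move=> /scale_monomialsP[f /LP[Gf le_f] ->].
  by rewrite addmC; apply/shift_high.
- move=> /scale_monomialsP[f /RP[Gf lt_f] ->].
  by rewrite addmC; apply: low => //; nia.
rewrite mem_iota => lt_j -> /scale_monomialsP[f /MP[Gf /andP[le_f lt_f]] ->].
have -> : r.+1 + l = r.+1 + j + (l - j) by lia.
by rewrite xypowD; apply/shift_high; [rewrite deg_yDx | apply: low => //; nia].
Qed.

Lemma disjoint_union_of_shifts : is_disjoint_union (G (r.+1 + l)) blocks.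
Proof.
split; last exact: blocks_disjoint.
apply/fsetP => m; apply/idP/bigfcupP => [/mem_blocks[B sB Bm]|[B]].
  by exists B; rewrite ?andbT.
by rewrite andbT => sB Bm; apply/mem_blocks; exists B.
Qed.

Lemma card_of_shifts : #|` G (r.+1 + l)| = #|` G r.+1| + l * #|` M|.
Proof.
rewrite (card_disjoint_union _ _ _ disjoint_union_of_shifts).
rewrite big_cons -cats1 big_cat big_seq1 big_map /= !card_scale_monomials.
under eq_bigr do rewrite card_scale_monomials.
rewrite big_const_seq count_predT size_iota iter_addn_0 mulnC.
rewrite addnCA addnC; congr (_ + _).
(* L and R are complementary in G r.+1. *)
rewrite -cardfsUI; have /eqP -> : L `&` R == fset0.
  rewrite fsetI_eq0; apply: (disjoint_deg_y _ _ (r * v)) => m; first by case/LP.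
  by case/RP.
rewrite cardfs0 addn0; congr #|` _|; apply/fsetP => m.
by rewrite !inE -andb_orr leqNgt orNb andbT.
Qed.

End Decomposition.

(** * Anchored ideals *)

(** Among the minimal generators of an anchored ideal are a pure power of x and
    a pure power of y: these are the minimal generators dividing the pure
    powers that the ideal contains. *)
Lemma anchored_mingens (k : fieldType) (J : set {mpoly k[2]}) :
  is_monomial_ideal J -> ideal_neq0 J -> is_anchored J ->
  J = monomial_ideal_gen [set` mingens J] /\
  exists a b, xpow a \in mingens J /\ ypow b \in mingens J.
Proof.
move=> monJ J_neq0 anchJ.
have [a0 [b0 [Ja0 Jb0]]] := anchored_pure_powers monJ J_neq0 anchJ.
have [J_gen _] := mingensP monJ Ja0 Jb0; split=> //.
have JX m : J 'X_[m] -> exists2 s, s \in mingens J & (s <= m)%MM.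
  by rewrite [in J _]J_gen monomial_ideal_genX.
have [s As /mnm2_leP[_]] := JX _ Ja0.
have [t At /mnm2_leP[+ _]] := JX _ Jb0.
rewrite xpow_iy ypow_ix !leqn0 => /eqP t0 /eqP s0; exists (s ix), (t iy).
have -> : xpow (s ix) = s by apply: mnm2_eq; rewrite !coordE.
by have -> : ypow (t iy) = t by apply: mnm2_eq; rewrite !coordE.
Qed.

Lemma anchored_deg_y_le (k : fieldType) (J : set {mpoly k[2]}) m :
  is_anchored J -> m \in mingens J -> deg_y m <= dist_y J.
Proof. by move=> anchJ Jm; rewrite /dist_y -anchJ; exact: leq_bigmax_seq. Qed.

Lemma ceil_div_le (d v r : nat) : 0 < v ->
  (Num.ceil (d%:R / v%:R : rat) <= r%:Z)%R -> d <= r * v.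
Proof.
move=> v_gt0; rewrite Num.Theory.ceil_le_int.
rewrite Num.Theory.ler_pdivrMr ?Num.Theory.ltr0n //.
by rewrite -[((r%:Z)%:~R)%R]/(r%:R)%R -natrM Num.Theory.ler_nat.
Qed.

Theorem theorem4p4 (k : fieldType) (u v : nat) (J : set {mpoly k[2]}) :
  0 < u -> 0 < v ->
  is_monomial_ideal J -> ideal_neq0 J -> is_anchored J ->
  forall r l : nat,
  (Num.ceil ((dist_y J)%:R / v%:R : rat) <= r%:Z)%R ->
  let Q n := ideal_mul (ideal_exp (xy_power_ideal k u v) n) J in
  let G0 := mingens (Q r.+1) in
  let L := [fset f in G0 | r * v <= deg_y f] in
  let M := [fset f in G0 | r * v <= deg_y f < r.+1 * v] in
  let R := [fset f in G0 | deg_y f < r * v] in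
  is_disjoint_union (mingens (Q (r.+1 + l)))
    (scale_monomials (ypow (v * l)) L
     :: rcons [seq scale_monomials (xypow (u * j) (v * (l - j))) M
              | j <- iota 1 l]
              (scale_monomials (xpow (u * l)) R)) /\
  mu (Q (r.+1 + l)) = mu (Q r.+1) + l * #|` M|.
Proof.
move=> u_gt0 v_gt0 monJ J_neq0 anchJ r l /(ceil_div_le _ _ _ v_gt0) le_d Q.
have [J_gen [a [b [Aa Ab]]]] := anchored_mingens _ _ monJ J_neq0 anchJ.
pose S := [set p | [set` mingens J] (xypow p.1 p.2)]%classic.
have le_S s t : S (s, t) -> t <= r * v.
  move=> /(anchored_deg_y_le _ _ _ anchJ); rewrite /deg_y !coordE add0n => le_t.
  exact: leq_trans le_t le_d.
have S0b : S (0, b).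
  have : xypow 0 b = ypow b by apply: mnm2_eq; rewrite !coordE.
  by rewrite /S /= => ->.
have QP n m : m \in mingens (Q n) <-> corner (staircase u v S n) (m ix, m iy).
  by rewrite /Q [X in ideal_mul _ X]J_gen; apply: mingens_power_product Aa Ab.
have shift_low n j m : deg_y m < n.+1 * v -> m \in mingens (Q (n + j)) <->
    exists2 f, f \in mingens (Q n) & m = (f + xpow (u * j))%MM.
  move=> lt_m; rewrite QP corner_staircase_low //.
  split=> [[le_u min_m]|[f /QP min_f ->]]; last first.
    by rewrite !coordE addn0 addnK; split=> //; exact: leq_addl.
  exists (m - xpow (u * j))%MM; last first.
    by rewrite submK //; apply/mnm2_leP; rewrite !coordE.
  by apply/QP; rewrite !mnmBE !coordE subn0.
have shift_high n j m : r * v <= deg_y m ->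
    (m + ypow (v * j))%MM \in mingens (Q (n + j)) <-> m \in mingens (Q n).
  move=> le_m; rewrite !QP !coordE addn0.
  exact: (corner_staircase_high _ _ _ u_gt0 v_gt0 _ _ _ _ _ _ le_S S0b).
split.
  exact: (disjoint_union_of_shifts _ _ _ _ _ v_gt0 shift_low shift_high).
exact: (card_of_shifts _ _ _ _ _ v_gt0 shift_low shift_high).
Qed.
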